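(* Let $r\ge2$ be a prime, let $t$ be rational with $t\ne0,\pm1,\pm2$, and let $t_r=C_r(t)$. Then $t_r\neq0,\pm1,\pm2$ and $\Pi(t_r)=\Pi(t)$. For any prime $p\in\Pi(t)$ not dividing the numerator of $U_r(t)$: if $r\nmid\chi(t,p)$ then $\chi(t_r,p)=\chi(t,p)$, and if $r\mid\chi(t,p)$ then $\chi(t_r,p)=\chi(t,p)/r$. Further, $$\Pi_0(t_r,r)=\Pi_0(t,r)\cup\Pi_1(t,r),\qquad \Pi_j(t_r,r)=\Pi_{j+1}(t,r)\quad\text{for } j=1,2,\dots .$$
   Context: For rational $t$ put $D_t=\begin{pmatrix}0&-1\\1&t\end{pmatrix}$. Chebyshev polynomials: $C_0(x)=2$, $C_1(x)=x$, $C_{n+1}=xC_n-C_{n-1}$; $U_0(x)=0$, $U_1(x)=1$, $U_{n+1}=xU_n-U_{n-1}$. For a fixed prime $r$ and rational $t\ne 0,\pm1,\pm2$, $\Pi(t)$ is the set of primes $p\ge 3$, $p\neq r$, not dividing the denominator of $t$. For $p\in\Pi(t)$ the index $\chi(t,p)$ is the smallest integer $k\ge1$ with $D_t^k\equiv I \pmod p$. For $j\ge 0$, $\Pi_j(t,r)=\{p\in\Pi(t) : r^j \,\|\, \chi(t,p)\}$ (exact power of $r$ dividing the index). *)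

(* Defs.v *)
From HB Require Import structures.
From mathcomp Require Import all_boot all_order all_algebra.
From mathcomp Require Import boolp classical_sets.

Set Implicit Arguments.
Unset Strict Implicit.
Unset Printing Implicit Defensive.

Import Order.TTheory GRing.Theory Num.Theory.

Local Open Scope classical_set_scope.
Local Open Scope ring_scope.

Definition matD (t : rat) : 'M[rat]_2 :=
  \matrix_(i < 2, j < 2) nth 0 (nth [::] [:: [:: 0; -1]; [:: 1; t]] i) j.

Fixpoint chebC (n : nat) : {poly rat} :=
  match n with
  | 0 => 2
  | n1.+1 => match n1 with
             | 0 => 'X
             | n2.+1 => 'X * chebC n1 - chebC n2
             end
  end.

(* Indexed so that [chebU n] has degree [n - 1]; in particular [chebU 0 = 0]. *)
Fixpoint chebU (n : nat) : {poly rat} :=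
  match n with
  | 0 => 0
  | n1.+1 => match n1 with
             | 0 => 1
             | n2.+1 => 'X * chebU n1 - chebU n2
             end
  end.

Definition excluded : seq rat := [:: 0; 1; -1; 2; -2].

(* Since [numq x] is the numerator in lowest terms, this says that a - b lies
   in the ideal generated by p in the rationals with denominator prime to p. *)
Definition ratcong (p : nat) (a b : rat) : bool := (p%:Z %| numq (a - b))%Z.

Definition mxcong (p : nat) (A B : 'M[rat]_2) : bool :=
  [forall i, forall j, ratcong p (A i j) (B i j)].

(* The value 0 when no such k exists is a convention; if p is a prime not
   dividing the denominator of t, then [matD t] is invertible mod p and
   such a k exists. *)
Definition chi (t : rat) (p : nat) : nat :=
  match pselect (exists k, (0 < k)%N && mxcong p (matD t ^+ k) 1) with
  | left h => ex_minn h
  | right _ => 0%N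
  end.

Definition Pi (r : nat) (t : rat) : set nat :=
  [set p | [/\ prime p, (3 <= p)%N, p != r & ~~ (p%:Z %| denq t)%Z]].

Definition exact_pow (r j n : nat) : bool :=
  (r ^ j %| n)%N && ~~ (r ^ j.+1 %| n)%N.

Definition Pi_ (j : nat) (t : rat) (r : nat) : set nat :=
  [set p | Pi r t p /\ exact_pow r j (chi t p)].

(* Main.v *)
Require Import Defs.
From HB Require Import structures.
From mathcomp Require Import all_boot all_order all_algebra.
From mathcomp Require Import boolp classical_sets.
From mathcomp Require Import fingroup cyclic finalg ring lra.

Set Implicit Arguments.
Unset Strict Implicit.
Unset Printing Implicit Defensive.

Import Order.TTheory GRing.Theory Num.Theory.

Local Open Scope classical_set_scope.
Local Open Scope ring_scope.

(** Everything happens among the 2 x 2 matrices over the field 'F_p.  Call x a root of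
    trace s if x^2 = s x - 1, that is x + x^-1 = s.  By Cayley-Hamilton the
    companion matrix of trace s is such a root, and any root satisfies
      x^k = U_k(s) x - U_(k-1)(s)   and   x^n + x^-n = C_n(s).
    The first formula shows that, for x not a scalar, whether x^k = 1 depends
    on s alone ([quad_exp1]).  Hence the index of t at p is the order of any
    nonscalar root u of trace t mod p ([chi_order]).  The second formula says
    that u^r is a root of trace C_r(t).

    If U_r(t) is nonzero mod p, then u^r is not a scalar, so the index of
    C_r(t) is the order of u^r, namely the order of u divided by its gcd with r
    ([chi_valC]).

    If U_r(t) = 0 mod p, then u^r is a scalar a; u^-1 has the same r-th power,
    so a = 1 or a = -1, and C_r(t) = 2a.  Let e be the order of a.  Since u is
    not a power of the scalar u^r, the order of u is r e; and a nonscalar root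
    of trace 2a is a times a unipotent element, so it has order p e
    ([order_degenerate]).  As p <> r, passing from t to C_r(t) again lowers the
    r-adic valuation of the index by one.

    So in every case the valuation of the index at C_r(t) is the truncated
    predecessor of the valuation at t ([logn_chi_valC]), which is the statement
    on the sets Pi_j.  Finally C_r is monic with integer coefficients, so the
    denominator of C_r(t) is the r-th power of that of t ([denq_valC]): this
    gives Pi(C_r(t)) = Pi(t), and keeps nonintegers away from the excluded
    values, whereas C_r(t) stays larger than 2 in absolute value when t is
    ([valC_norm_gt2]). *)

(** * Chebyshev values and roots of x^2 = s x - 1 *)

(** The common recurrence of C and U, as values in an arbitrary ring: the
    polynomials have rational coefficients and cannot be evaluated in 'F_p. *)
Fixpoint lucas (R : pzRingType) (a b x : R) (n : nat) : R :=
  match n with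
  | 0 => a
  | n1.+1 => match n1 with
             | 0 => b
             | n2.+1 => x * lucas a b x n1 - lucas a b x n2
             end
  end.

Definition valU (R : pzRingType) (x : R) : nat -> R := lucas 0 1 x.
Definition valC (R : pzRingType) (x : R) : nat -> R := lucas 2 x x.

Lemma lucasSS (R : pzRingType) (a b x : R) n :
  lucas a b x n.+2 = x * lucas a b x n.+1 - lucas a b x n.
Proof. by []. Qed.

Lemma nat_ind2 (P : nat -> Prop) :
  P 0%N -> P 1%N -> (forall n, P n -> P n.+1 -> P n.+2) -> forall n, P n.
Proof.
move=> P0 P1 PSS n; suff [] : P n /\ P n.+1 by [].
by elim: n => // n [Pn PSn]; split=> //; apply: PSS.
Qed.

Lemma horner_chebU n (t : rat) : (chebU n).[t] = valU t n.
Proof.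
elim/nat_ind2: n => [||n IHn IHSn]; rewrite ?hornerC //.
by rewrite [chebU _]/(_ - _) hornerD hornerN hornerM hornerX IHn IHSn.
Qed.

Lemma horner_chebC n (t : rat) : (chebC n).[t] = valC t n.
Proof.
elim/nat_ind2: n => [||n IHn IHSn]; rewrite ?hornerX //.
  by rewrite -[chebC 0]/(2%:R) -polyC_natr hornerC.
by rewrite [chebC _]/(_ - _) hornerD hornerN hornerM hornerX IHn IHSn.
Qed.

Section Quadratic.
Variables (R : comNzRingType) (A : algType R) (s : R) (x : A).
Hypothesis x_quad : x * x = s *: x - 1.

(** Cayley-Hamilton, iterated: the recurrence of U is multiplication by [x] in
    the basis 1, [x]. *)
Lemma quad_exp k : x ^+ k.+1 = valU s k.+1 *: x - (valU s k)%:A.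
Proof.
elim: k => [|k IHk]; first by rewrite expr1 scale1r scale0r subr0.
rewrite exprSr IHk mulrBl -!scalerAl x_quad mul1r scalerBr scalerA.
by rewrite [in RHS]/valU lucasSS scalerBl [_ * s]mulrC addrAC.
Qed.

Lemma quad_inv : x * (s%:A - x) = 1.
Proof. by rewrite mulrBr x_quad -scalerAr mulr1 opprB addrC subrK. Qed.

Lemma quad_conj : (s%:A - x) * (s%:A - x) = s *: (s%:A - x) - 1.
Proof. by rewrite mulrBl quad_inv -scalerAl mul1r. Qed.

(** Both [x] and its inverse are roots, so their powers, hence the sum of these,
    obey the recurrence of C. *)
Lemma quad_trace n : x ^+ n + (s%:A - x) ^+ n = (valC s n)%:A.
Proof.
elim/nat_ind2: n => [||n IHn IHSn].
- by rewrite !expr0 scaler_nat.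
- by rewrite !expr1 addrC subrK.
rewrite [in RHS]/valC lucasSS scalerBl -scalerA -/(valC s n) -/(valC s n.+1).
have quadSS (z : A) : z * z = s *: z - 1 -> z ^+ n.+2 = s *: z ^+ n.+1 - z ^+ n.
  by move=> zq; rewrite !exprSr -mulrA zq mulrBr mulr1 -scalerAr.
rewrite -IHn -IHSn scalerDr opprD addrACA.
by rewrite (quadSS _ x_quad) (quadSS _ quad_conj).
Qed.

Lemma quad_exp_quad n : x ^+ n * x ^+ n = valC s n *: x ^+ n - 1.
Proof.
have xyn : x ^+ n * (s%:A - x) ^+ n = 1.
  rewrite -exprMn_comm ?quad_inv ?expr1n //.
  by rewrite /GRing.comm mulrBr mulrBl -scalerAl -scalerAr mulr1 mul1r.
rewrite -[_ *: x ^+ n]mulr1 -scalerAl scalerAr -quad_trace mulrDr xyn.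
by rewrite addrK.
Qed.

End Quadratic.

Definition nonscalar (R : pzRingType) (A : lalgType R) (x : A) : Prop :=
  forall a : R, x <> a%:A.

(** [x] and 1 are linearly independent. *)
Lemma nonscalar_comb (F : fieldType) (A : algType F) (x : A) (a b : F) :
  nonscalar x -> a *: x = b%:A -> a = 0 /\ b = 0.
Proof.
move=> nsx eqab; case: (eqVneq a 0) => [a0|a0]; last first.
  case: (nsx (a^-1 * b)); by rewrite -scalerA -eqab scalerA mulVf // scale1r.
split=> //; move/eqP: eqab; rewrite a0 scale0r eq_sym scaler_eq0 oner_eq0 orbF.
by move/eqP.
Qed.

(** The right-hand side does not mention [x]: all nonscalar roots of the same
    trace have the same order. *)
Lemma quad_exp1 (F : fieldType) (A : algType F) (s : F) (x : A) k :
  x * x = s *: x - 1 -> nonscalar x ->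
  (x ^+ k.+1 == 1) = (valU s k.+1 == 0) && (valU s k == -1).
Proof.
move=> xq nsx; rewrite (quad_exp xq); apply/eqP/andP.
  move=> /eqP; rewrite subr_eq -[X in X + _]scale1r -scalerDl => /eqP.
  case/(nonscalar_comb nsx) => -> /eqP; rewrite eqxx addrC addr_eq0.
  by split.
by case=> /eqP-> /eqP->; rewrite scale0r sub0r scaleNr scale1r opprK.
Qed.

Lemma quad_exp_nonscalar (F : fieldType) (A : algType F) (s : F) (x : A) n :
  x * x = s *: x - 1 -> nonscalar x -> valU s n.+1 != 0 -> nonscalar (x ^+ n.+1).
Proof.
move=> xq nsx Un0 a /eqP; rewrite (quad_exp xq) subr_eq -scalerDl => /eqP.
by case/(nonscalar_comb nsx) => /eqP; rewrite (negPf Un0).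
Qed.

(** A vanishing U_n makes x^n the scalar a = - U_(n-1).  The inverse of x is a
    root of the same trace, so x^-n = a too, whence a^2 = 1 and C_n = 2a. *)
Lemma quad_exp_scalar (F : fieldType) (A : algType F) (s : F) (x : A) n :
  x * x = s *: x - 1 -> valU s n.+1 = 0 ->
  exists2 a : F, x ^+ n.+1 = a%:A & a * a = 1 /\ valC s n.+1 = 2 * a.
Proof.
move=> xq Un0; pose a := - valU s n.
have Ainj : injective (fun a : F => a%:A : A) := @fmorph_inj _ _ (GRing.in_alg A).
have root_exp (y : A) : y * y = s *: y - 1 -> y ^+ n.+1 = a%:A.
  by move=> yq; rewrite (quad_exp yq) Un0 scale0r sub0r scaleNr.
have xn := root_exp x xq; exists a => //.
have Ctwo : valC s n.+1 = 2 * a.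
  apply: Ainj; rewrite -(quad_trace xq) (root_exp _ (quad_conj xq)) xn -scalerDl.
  by congr (_ *: _); ring.
split=> //; apply: Ainj.
move: (quad_exp_quad xq n.+1); rewrite xn Ctwo -scalerAl mul1r !scalerA => /eqP.
rewrite -subr_eq0 opprB addrCA -scalerBl addrC => /eqP h.
have {h} : (a * a - 2 * a * a)%:A = - 1 :> A by apply/eqP; rewrite -addr_eq0 h.
have -> : a * a - 2 * a * a = - (a * a) by ring.
by move/eqP; rewrite scaleNr eqr_opp scale1r => /eqP.
Qed.

(** For trace 2a with a^2 = 1 the characteristic polynomial is (X - a)^2, so
    a x = 1 + y with y^2 = 0, and (1 + y)^k = 1 + k y. *)
Lemma quad_exp_double (F : fieldType) (A : algType F) (a : F) (x : A) k :
  a * a = 1 -> x * x = (2 * a) *: x - 1 ->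
  x ^+ k = a ^+ k *: (1 + k%:R *: (a *: x - 1)).
Proof.
move=> aa xq; elim: k => [|k IHk]; first by rewrite !expr0 scale0r addr0 scale1r.
pose y := a *: x - 1.
have xE : x = a *: (1 + y) by rewrite addrC subrK scalerA aa scale1r.
have y2 : y * y = 0.
  rewrite /y mulrBl mul1r mulrBr mulr1 -scalerAl -scalerAr xq scalerA aa scale1r.
  have -> : (2 * a) *: x = a *: x + a *: x by rewrite mulr_natl mulr2n scalerDl.
  by rewrite -addrA -opprD addrA subrr.
rewrite exprSr IHk -/y {1}xE -scalerAl -scalerAr scalerA -exprSr.
congr (_ *: _); rewrite mulrDl mul1r mulrDr mulr1 -scalerAl y2 scaler0 addr0.
by rewrite -natr1 scalerDl scale1r addrAC -addrA.
Qed.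

Lemma quad_exp_double1 (F : fieldType) (A : algType F) (a : F) (x : A) k :
  a * a = 1 -> x * x = (2 * a) *: x - 1 -> nonscalar x ->
  (x ^+ k == 1) = (k%:R == 0 :> F) && (a ^+ k == 1).
Proof.
move=> aa xq nsx; rewrite (quad_exp_double k aa xq).
have a0 : a != 0 by apply: contra_eq_neq aa => ->; rewrite mul0r eq_sym oner_eq0.
apply/eqP/andP; last by case=> /eqP-> /eqP->; rewrite scale0r addr0 scale1r.
move=> eq1.
have: (a ^+ k * (k%:R * a)) *: x = (1 - a ^+ k + a ^+ k * k%:R)%:A.
  rewrite scalerDl scalerBl scale1r -[X in X - _]eq1 scalerDr [_ - _]addrAC.
  by rewrite subrr add0r !scalerBr !scalerA subrK mulrA.
case/(nonscalar_comb nsx) => /eqP; rewrite mulf_eq0 expf_eq0 (negPf a0) andbF /=.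
rewrite mulf_eq0 (negPf a0) orbF => /eqP-> /eqP.
by rewrite mulr0 addr0 subr_eq0 eq_sym eqxx.
Qed.
(** * Orders of 2 x 2 matrices of determinant 1 *)

Definition companion (R : pzRingType) (s : R) : 'M[R]_2 :=
  \matrix_(i < 2, j < 2) nth 0 (nth [::] [:: [:: 0; -1]; [:: 1; s]] i) j.

Lemma companion_quad (R : comNzRingType) (s : R) :
  companion s * companion s = s *: companion s - 1.
Proof.
apply/matrixP => i j; rewrite !mxE !big_ord_recl big_ord0 !mxE.
by case: i => [[|[|[]]] ?] //; case: j => [[|[|[]]] ?] //=; ring.
Qed.

Section OrderInMatrices.
Variables (F : finFieldType).
Implicit Types u : {unit 'M[F]_2}.

(** For a nonscalar 2 x 2 matrix the quadratic relation says precisely that the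
    trace is [s] and the determinant 1. *)
Definition has_trace (s : F) u : Prop :=
  val u * val u = s *: val u - 1 /\ nonscalar (val u).

Lemma has_trace_exists s : exists u, has_trace s u.
Proof.
have uD : companion s \is a GRing.unit.
  by case/mulmx1_unit: (quad_inv (companion_quad s)).
exists (FinRing.unit _ uD); split=> [|a /matrixP/(_ (lift ord0 ord0) ord0)].
  exact: companion_quad.
by rewrite !mxE /= mulr0 => /eqP; rewrite oner_eq0.
Qed.

Lemma unit_exp1 u k : ((u ^+ k)%g == 1%g) = (val u ^+ k == 1).
Proof. by rewrite -FinRing.val_unitX -FinRing.val_unit1 (inj_eq val_inj). Qed.

Lemma has_trace_exp s u n :
  valU s n.+1 != 0 -> has_trace s u -> has_trace (valC s n.+1) (u ^+ n.+1)%g.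
Proof.
move=> Un0 [uq nsu]; split; rewrite FinRing.val_unitX.
  exact: quad_exp_quad.
exact: quad_exp_nonscalar Un0.
Qed.

(** The case where u^r is a scalar a; the witness e is the order of a.  If r did
    not divide the order of u, then u would be a power of u^r, hence a scalar.
    A root of trace 2a satisfies v^k = 1 iff p divides k and a^k = 1; since
    a^2 = 1 and p is odd, these two conditions combine to p e dividing k. *)
Lemma order_degenerate (p r : nat) s u v :
    p \in [pchar F] -> (2 < p)%N -> prime r -> valU s r = 0 ->
    has_trace s u -> has_trace (valC s r) v ->
  exists2 e, #[u]%g = (r * e)%N & #[v]%g = (p * e)%N.
Proof.
case: r => // r pF p3 r_pr Ur0 [uq nsu] [vq nsv].
have [a xa [aa Ca]] := quad_exp_scalar uq Ur0.
have urk k : ((u ^+ r.+1 ^+ k)%g == 1%g) = (a ^+ k == 1).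
  rewrite -expgM unit_exp1 exprM xa -(inj_eq (fmorph_inj (GRing.in_alg 'M[F]_2))).
  by rewrite rmorphXn rmorph1.
exists #[u ^+ r.+1]%g.
  have r_dvd : (r.+1 %| #[u]%g)%N.
    apply: contraT; rewrite -prime_coprime // coprime_sym => co.
    have /(_ u (cycle_id u)) := @expgK _ <[u]>%G r.+1 co.
    move/(congr1 val); rewrite !FinRing.val_unitX xa => ua.
    case: (nsu (a ^+ expg_invn <[u]> r.+1)); rewrite -ua.
    by rewrite -[a%:A]/(GRing.in_alg _ a) -rmorphXn.
  by rewrite orderXgcd (gcdn_idPr r_dvd) mulnC divnK.
rewrite Ca in vq; apply/eqP; rewrite eqn_dvd.
have key k : (#[v]%g %| k)%N = (p * #[u ^+ r.+1]%g %| k)%N.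
  rewrite Gauss_dvd; last first.
    rewrite coprime_sym; apply: (@coprime_dvdl _ 2).
      by rewrite order_dvdn urk expr2 aa.
    by rewrite coprime2n; case/andP: pF => /even_prime[p2|//]; rewrite p2 in p3.
  by rewrite !order_dvdn unit_exp1 (quad_exp_double1 _ aa vq nsv) urk (dvdn_pcharf pF).
by rewrite key dvdnn -key dvdnn.
Qed.

End OrderInMatrices.

(** * Reduction of rational numbers modulo a prime *)

Section Reduction.
Variable F : fieldType.
Implicit Types x y t : rat.

(** On these rationals [ratr] is the reduction map to [F].  It is not a
    morphism on all of rat when [F] has positive characteristic, hence the
    lemmas below. *)
Definition reducible x : bool := (denq x)%:~R != 0 :> F.

(** Reduction can be computed on any fraction with nonzero denominator in [F],
    in lowest terms or not, so that sums and products of fractions need no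
    simplification. *)
Lemma reduce_frac (n d : int) : d%:~R != 0 :> F ->
  reducible (n%:~R / d%:~R) /\ ratr (n%:~R / d%:~R) = n%:~R / d%:~R :> F.
Proof.
rewrite /reducible; case: divqP => [|k x k0]; first by rewrite eqxx.
rewrite !intrM mulf_eq0 negb_or => /andP[Fk0 Fd0]; split=> //.
by rewrite /ratr invfM mulrACA divff ?mul1r.
Qed.

Lemma reduceB x y : reducible x -> reducible y ->
  reducible (x - y) /\ ratr (x - y) = ratr x - ratr y :> F.
Proof.
move=> rx ry; have d0 : (denq x * denq y)%:~R != 0 :> F.
  by rewrite intrM mulf_neq0.
have {1 2}-> : x - y = (numq x * denq y - numq y * denq x)%:~R
                       / (denq x * denq y)%:~R.
  rewrite -{1}[x]divq_num_den -{1}[y]divq_num_den.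
  by field; rewrite !intr_eq0 !denq_neq0.
have [-> ->] := reduce_frac (numq x * denq y - numq y * denq x) d0.
by split=> //; rewrite /ratr; field; move: rx ry; rewrite /reducible => -> ->.
Qed.

Lemma reduceM x y : reducible x -> reducible y ->
  reducible (x * y) /\ ratr (x * y) = ratr x * ratr y :> F.
Proof.
move=> rx ry; have d0 : (denq x * denq y)%:~R != 0 :> F.
  by rewrite intrM mulf_neq0.
have {1 2}-> : x * y = (numq x * numq y)%:~R / (denq x * denq y)%:~R.
  rewrite -{1}[x]divq_num_den -{1}[y]divq_num_den.
  by field; rewrite !intr_eq0 !denq_neq0.
have [-> ->] := reduce_frac (numq x * numq y) d0.
by split=> //; rewrite /ratr; field; move: rx ry; rewrite /reducible => -> ->.
Qed.

Lemma reduce_lucas a b t n : reducible a -> reducible b -> reducible t ->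
  reducible (lucas a b t n) /\
  ratr (lucas a b t n) = lucas (ratr a) (ratr b) (ratr t) n :> F.
Proof.
move=> ra rb rt; elim/nat_ind2: n => // n [rn en] [rn1 en1]; rewrite !lucasSS.
have [rm em] := reduceM rt rn1; have [rd ed] := reduceB rm rn.
by rewrite rd ed em en en1.
Qed.

Lemma reducible_int (z : int) : reducible z%:~R.
Proof. by rewrite /reducible denq_int oner_eq0. Qed.

Lemma reduce_valU t n : reducible t ->
  reducible (valU t n) /\ ratr (valU t n) = valU (ratr t) n :> F.
Proof.
move=> rt.
have := @reduce_lucas 0 1 t n (reducible_int 0) (reducible_int 1) rt.
by rewrite (ratr_int F 0) (ratr_int F 1).
Qed.

Lemma reduce_valC t n : reducible t ->
  reducible (valC t n) /\ ratr (valC t n) = valC (ratr t) n :> F.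
Proof.
move=> rt; have := @reduce_lucas 2 t t n (reducible_int 2) rt rt.
by rewrite (ratr_int F 2).
Qed.

End Reduction.

Section ReductionModPrime.
Variables (p : nat) (p_pr : prime p).

Lemma reducible_dvd x : reducible 'F_p x = ~~ (p%:Z %| denq x)%Z.
Proof. by rewrite (dvdz_pcharf (pchar_Fp p_pr)). Qed.

Lemma ratcong_reduce x y : reducible 'F_p x -> reducible 'F_p y ->
  ratcong p x y = (ratr x == ratr y :> 'F_p).
Proof.
move=> rx ry; have [rd ed] := reduceB rx ry.
rewrite /ratcong (dvdz_pcharf (pchar_Fp p_pr)) -[RHS]subr_eq0 -ed /ratr.
by rewrite mulf_eq0 invr_eq0 (negPf rd) orbF.
Qed.

Lemma mxcong_valU t k : reducible 'F_p t ->
  mxcong p (matD t ^+ k.+1) 1 =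
  (valU (ratr t : 'F_p) k.+1 == 0) && (valU (ratr t : 'F_p) k == -1).
Proof.
move=> rt; rewrite (quad_exp (companion_quad t : matD t * matD t = t *: matD t - 1)).
have [r1 e1] := reduce_valU k.+1 rt; have [r0 e0] := reduce_valU k rt.
have [rt1 et1] := reduceM r1 rt.
have [rz ez] : reducible 'F_p 0 /\ ratr 0 = 0 :> 'F_p.
  by split; [exact: (reducible_int _ 0) | rewrite (ratr_int _ 0)].
have [ro eo] : reducible 'F_p 1 /\ ratr 1 = 1 :> 'F_p.
  by split; [exact: (reducible_int _ 1) | rewrite (ratr_int _ 1)].
have [rn0 en0] := reduceB rz r0; have [rn1 en1] := reduceB rz r1.
have [rd ed] := reduceB rt1 r0.
set M := _ - _.
have M00 : M ord0 ord0 = 0 - valU t k by rewrite !mxE /=; ring.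
have M01 : M ord0 (lift ord0 ord0) = 0 - valU t k.+1 by rewrite !mxE /=; ring.
have M10 : M (lift ord0 ord0) ord0 = valU t k.+1 by rewrite !mxE /=; ring.
have M11 : M (lift ord0 ord0) (lift ord0 ord0) = valU t k.+1 * t - valU t k.
  by rewrite !mxE /=; ring.
apply/forallP/andP => [H|[/eqP U1 /eqP U0] i].
  move: (H ord0) (H (lift ord0 ord0)) => /forallP/(_ ord0) H00 /forallP/(_ ord0).
  rewrite M10 !mxE /= ratcong_reduce // e1 ez => U1; split=> //.
  move: H00; rewrite M00 !mxE /= ratcong_reduce // en0 e0 ez eo sub0r.
  by rewrite eqr_oppLR.
apply/forallP => j.
have Fi (l : 'I_2) : l = ord0 \/ l = lift ord0 ord0.
  by case: l => [[|[|[]]] ?] //; [left|right]; apply: val_inj.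
case: (Fi i) => ->; case: (Fi j) => ->; rewrite ?M00 ?M01 ?M10 ?M11 !mxE /=;
  rewrite ratcong_reduce // ?en0 ?en1 ?ed ?et1 ?e0 ?e1 ?U1 ?U0 ?ez ?eo ?mul0r;
  by rewrite ?sub0r ?opprK ?oppr0.
Qed.

(** Congruence mod p of the powers of [matD t] is governed by the conditions on
    U that also decide when u^k = 1, so the matrix whose order is taken may be
    replaced by any [u] of the same trace: this is what lets u^r stand for the
    companion matrix of C_r(t). *)
Lemma chi_order t (u : {unit 'M['F_p]_2}) : reducible 'F_p t -> has_trace (ratr t) u ->
  chi t p = #[u]%g.
Proof.
move=> rt [uq nsu].
have key k : (0 < k)%N -> mxcong p (matD t ^+ k) 1 = (#[u]%g %| k)%N.
  by case: k => // k _; rewrite mxcong_valU // order_dvdn unit_exp1 (quad_exp1 _ uq).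
rewrite /chi; case: pselect => [h|[]]; last first.
  by exists #[u]%g; rewrite order_gt0 key ?order_gt0 // dvdnn.
case: ex_minnP => m /andP[m0]; rewrite key // => dm minm.
apply/eqP; rewrite eqn_leq [X in _ && X]dvdn_leq // andbT.
by apply: minm; rewrite order_gt0 key ?order_gt0 // dvdnn.
Qed.

End ReductionModPrime.

(** * Denominator and size of C_n(t) *)

(** C_n is monic with integer coefficients, so D^n C_n(N / D) is congruent to
    N^n modulo D. *)
Lemma valC_frac (F : fieldType) (N D : int) n : D%:~R != 0 :> F -> exists e : int,
  valC (N%:~R / D%:~R : F) n.+1
  = (N ^+ n.+1 + e * D)%:~R / (D ^+ n.+1)%:~R.
Proof.
move=> d0.
have intrX (m : int) k : (m ^+ k)%:~R = m%:~R ^+ k :> F by rewrite rmorphXn.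
elim/nat_ind2: n => [||n [e IHn] [e1 IHSn]].
- by exists 0; rewrite mul0r addr0 !expr1.
- exists (- 2 * D); set x : F := _ / _.
  have -> : valC x 2 = x * x - 2 by [].
  rewrite /x !(intrX, intrD, intrM, mulrNz).
  by field.
(* The recurrence gives the numerator c_(k+2) = N c_(k+1) - D^2 c_k. *)
exists (N * e1 - D * (N ^+ n.+1 + e * D)).
set x : F := _ / _.
have -> : valC x n.+3 = x * valC x n.+2 - valC x n.+1 by [].
rewrite IHn IHSn /x.
rewrite !(intrX, intrB, intrD, intrM) !exprS.
by field; rewrite ?expf_neq0 ?d0.
Qed.

Lemma denq_valC t n : (0 < n)%N -> denq (valC t n) = denq t ^+ n.
Proof.
case: n => // n _; have d0 : (denq t)%:~R != 0 :> rat by rewrite intr_eq0 denq_neq0.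
have [e] := valC_frac (numq t) n d0.
rewrite divq_num_den => ->.
rewrite coprimeq_den; last first.
  rewrite -coprimezE; apply: coprimezXr; rewrite coprimez_sym /coprimez addrC.
  rewrite gcdzMDl -/(coprimez _ _) coprimez_sym; apply: coprimezXl.
  exact: coprime_num_den.
by rewrite expf_eq0 denq_eq0 andbF normrX normr_denq.
Qed.

(** From index 1 on, |C_(n+1)| >= |t| |C_n| - |C_(n-1)| >= 2 |C_n| - |C_n|: the
    induction has to carry that the absolute values do not decrease. *)
Lemma valC_norm_gt2 (R : realDomainType) (t : R) n : 2 < `|t| -> 2 < `|valC t n.+1|.
Proof.
move=> t2; suff [] : `|valC t n| <= `|valC t n.+1| /\ 2 < `|valC t n.+1| by [].
elim: n => [|n [le_n gt2]]; first by rewrite /valC /= normr_nat ltW.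
have h : `|valC t n.+1| <= `|valC t n.+2|.
  rewrite [valC t n.+2]lucasSS -/(valC t n) -/(valC t n.+1).
  apply: le_trans (lerB_dist _ _); rewrite normrM lerBrDr.
  apply: (@le_trans _ _ (2 * `|valC t n.+1|)); first lra.
  by rewrite ler_wpM2r // ltW.
by split=> //; apply: lt_le_trans h.
Qed.

Lemma excluded_int t : t \in excluded -> denq t = 1 /\ `|t| <= 2.
Proof. by rewrite !inE => /or4P[||| /orP[]] /eqP->. Qed.

Lemma int_excluded t : denq t = 1 -> `|t| <= 2 -> t \in excluded.
Proof.
move=> dt; have -> : t = (numq t)%:~R by rewrite numqE dt mulr1.
rewrite -intr_norm -[2]/(2%:~R) ler_int.
by case: (numq t) => [[|[|[|m]]]|[|[|m]]].
Qed.

Lemma valC_notin_excluded t n : t \notin excluded -> valC t n.+1 \notin excluded.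
Proof.
move=> ht; apply/negP => /excluded_int[dC nC].
case: (ltP 2 `|t|) => [/(valC_norm_gt2 n)|t2]; first by rewrite ltNge nC.
move: dC; rewrite denq_valC // => /eqP; rewrite pexpr_eq1 // ?denq_ge0 //.
by move/eqP => dt; rewrite int_excluded in ht.
Qed.

(** * The index at C_r(t) *)

Lemma exact_powE r j n : prime r -> (0 < n)%N ->
  exact_pow r j n = (logn r n == j).
Proof.
by move=> r_pr n0; rewrite /exact_pow !pfactor_dvdn // -leqNgt eq_sym eqn_leq.
Qed.

Section IndexAtValC.
Variables (r p : nat) (t : rat).
Hypotheses (r_pr : prime r) (p_pr : prime p) (rt : reducible 'F_p t).

Lemma chi_gt0 s : reducible 'F_p s -> (0 < chi s p)%N.
Proof.
move=> rs; have [u ut] := has_trace_exists (ratr s : 'F_p).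
by rewrite (chi_order p_pr rs ut) order_gt0.
Qed.

Lemma chi_valC : valU (ratr t : 'F_p) r != 0 ->
  chi (valC t r) p = (chi t p %/ gcdn (chi t p) r)%N.
Proof.
have [rC eC] := reduce_valC r rt.
have [u ut] := has_trace_exists (ratr t : 'F_p).
have := @has_trace_exp _ (ratr t) u r.-1; rewrite prednK ?prime_gt0 // -eC.
move=> h Ur; rewrite (chi_order p_pr rC (h Ur ut)) (chi_order p_pr rt ut).
exact: orderXgcd.
Qed.

(** When U_r(t) vanishes mod p the index r e becomes p e instead of being divided
    by r; only the valuation behaves in the same way in both cases. *)
Lemma logn_chi_valC : (2 < p)%N -> p != r ->
  logn r (chi (valC t r) p) = (logn r (chi t p)).-1.
Proof.
move=> p3 p_r; have t0 := chi_gt0 rt.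
have [Ur|Ur] := eqVneq (valU (ratr t : 'F_p) r) 0; last first.
  rewrite chi_valC //; have [rn|rn] := boolP (r %| chi t p)%N.
    by rewrite (gcdn_idPr rn) logn_div // (logn_prime _ r_pr) eqxx subn1.
  have /eqP-> : coprime (chi t p) r by rewrite coprime_sym prime_coprime.
  by rewrite divn1 lognE r_pr t0 (negPf rn).
have [rC eC] := reduce_valC r rt.
have [u ut] := has_trace_exists (ratr t : 'F_p).
have [v vt] := has_trace_exists (ratr (valC t r) : 'F_p).
rewrite (chi_order p_pr rC vt) (chi_order p_pr rt ut); rewrite eC in vt.
have [e ue ve] := order_degenerate (pchar_Fp p_pr) p3 r_pr Ur ut vt.
have e0 : (0 < e)%N by have := order_gt0 u; rewrite ue muln_gt0 => /andP[].
rewrite ue ve !lognM ?(prime_gt0 p_pr) ?(prime_gt0 r_pr) //.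
by rewrite (logn_prime _ r_pr) (logn_prime _ p_pr) eqxx eq_sym (negPf p_r).
Qed.

End IndexAtValC.

Theorem proposition11 (r : nat) (t : rat) (hr : prime r)
    (ht : t \notin excluded) :
  let tr := (chebC r).[t] in
  [/\ tr \notin excluded,
      Pi r tr = Pi r t,
      forall p : nat, Pi r t p -> ~~ (p%:Z %| numq (chebU r).[t])%Z ->
        (~~ (r %| chi t p)%N -> chi tr p = chi t p) /\
        ((r %| chi t p)%N -> chi tr p = (chi t p %/ r)%N),
      Pi_ 0 tr r = Pi_ 0 t r `|` Pi_ 1 t r &
      forall j : nat, (1 <= j)%N -> Pi_ j tr r = Pi_ j.+1 t r].
Proof.
move=> tr; have {}trE : tr = valC t r := horner_chebC r t; rewrite {}trE.
have r0 := prime_gt0 hr.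
have PiE : Pi r (valC t r) = Pi r t.
  apply/seteqP; split=> p [p_pr p3 p_r dp]; split=> //; move: dp;
    by rewrite denq_valC // !dvdzE abszX Euclid_dvdX // r0 andbT.
have logn_chi p : Pi r t p -> [/\ (0 < chi t p)%N, (0 < chi (valC t r) p)%N &
    logn r (chi (valC t r) p) = (logn r (chi t p)).-1].
  move=> [p_pr p3 p_r]; rewrite -reducible_dvd // => rt.
  split; [exact: chi_gt0 | | exact: logn_chi_valC].
  by apply: chi_gt0 => //; exact: (reduce_valC r rt).1.
split=> //.
- by rewrite -(prednK r0); apply: valC_notin_excluded.
- move=> p [p_pr p3 p_r]; rewrite -reducible_dvd // => rt.
  rewrite horner_chebU (dvdz_pcharf (pchar_Fp p_pr)) => Un.
  have [rU eU] := reduce_valU r rt.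
  have Ur : valU (ratr t : 'F_p) r != 0.
    by rewrite -eU /ratr mulf_neq0 ?invr_eq0.
  rewrite chi_valC //; split=> [rn|rn]; last by rewrite (gcdn_idPr rn).
  have /eqP-> : coprime (chi t p) r by rewrite coprime_sym prime_coprime.
  by rewrite divn1.
- apply/seteqP; split=> p.
    move=> [] ; rewrite PiE => pP; have [t0 C0 e] := logn_chi p pP.
    rewrite exact_powE // e; case E: (logn r (chi t p)) => [|[|k]] // _.
      by left; split; rewrite ?exact_powE ?E.
    by right; split; rewrite ?exact_powE ?E.
  by move=> [] [pP]; have [t0 C0 e] := logn_chi p pP; rewrite exact_powE // => /eqP E;
    split; rewrite ?PiE ?exact_powE // e E.
- move=> j j0; apply/seteqP; split=> p [].
    rewrite PiE => pP; have [t0 C0 e] := logn_chi p pP.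
    rewrite exact_powE // e => /eqP ej; split; rewrite ?exact_powE //.
    by move: ej j0; case: (logn r _) => [|k] /= <-.
  move=> pP; have [t0 C0 e] := logn_chi p pP.
  by rewrite exact_powE // => /eqP E; split; rewrite ?PiE ?exact_powE // e E.
Qed.
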